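(* Assume that $X[\mathcal{T}]$ is a locally convex topological vector space, $\mathcal{C}$ is a non-decreasing countable localizing family in $X$, each member of $\mathcal{C}$ is $\mathcal{T}$-closed, and for each $C\in\mathcal{C}$ the topology $\mathcal{T}|_C$ is sequential. Then the following hold. (A) If $V\subseteq X$ is convex and $\mathcal{T}_{\mathcal{C}}$-sequentially open then it is $\mathcal{T}_{\mathcal{C}}$-open. (B) If $Y[\mathcal{U}]$ is a locally convex topological vector space and $f:X\to Y$ is linear then the following are equivalent: (a) $f$ is $(\mathcal{T}_{\mathcal{C}},\mathcal{U})$-continuous; (b) $f$ is sequentially $(\mathcal{T}_{\mathcal{C}},\mathcal{U})$-continuous. (C) If $q$ is a seminorm on $X$ then the following are equivalent: (a) $q$ is $\mathcal{T}_{\mathcal{C}}$-continuous; (b) $q$ is sequentially $\mathcal{T}_{\mathcal{C}}$-continuous.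
   Context: All vector spaces are real; topological vector spaces are Hausdorff. $X[\mathcal{T}]$ denotes $X$ equipped with the topology $\mathcal{T}$; $\mathcal{T}|_C=\{E\cap C:E\in\mathcal{T}\}$. A localizing family in a vector space $X$ is a non-empty collection $\mathcal{C}$ of convex subsets of $X$ containing $0$ such that for all $C\in\mathcal{C}$, $x\in X$, $t\in\mathbb{R}$ there is $D\in\mathcal{C}$ with $x+t\cdot C\subseteq D$. It is non-decreasing countable if it can be numbered $\mathcal{C}=\{C_k:k\in\mathbb{N}\}$ with $C_k\subseteq C_{k+1}$ for all $k$. The localization $\mathcal{T}_{\mathcal{C}}$ is the locally convex vector topology on $X$ consisting of all $E\subseteq X$ such that for every $x\in E$ there is a convex $V$ with $x\in V\subseteq E$ and $V\cap C\in\mathcal{T}|_C$ for every $C\in\mathcal{C}$. A subset $A$ of a Hausdorff space is sequentially open if every sequence converging to a point of $A$ is eventually in $A$; the space (or its topology) is sequential if every sequentially open set is open. *)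

(* Defs.v *)
From HB Require Import structures.
From mathcomp Require Import all_boot all_order all_algebra.
From mathcomp Require Import all_classical all_reals all_analysis.

Set Implicit Arguments.
Unset Strict Implicit.
Unset Printing Implicit Defensive.

Import Order.TTheory GRing.Theory Num.Theory.
Import numFieldNormedType.Exports.

Local Open Scope classical_set_scope.
Local Open Scope ring_scope.

Section Sequential.

Definition sequentially_open (T : topologicalType) (A : set T) :=
  forall (u : nat -> T) (x : T),
    u @ \oo --> x -> A x -> \forall n \near \oo, A (u n).

Definition sequential_space (T : topologicalType) :=
  forall A : set T, sequentially_open A -> open A.

Definition sequentially_continuous (S T : topologicalType) (f : S -> T) :=
  forall (u : nat -> S) (x : S),
    u @ \oo --> x -> (f \o u) @ \oo --> f x.

End Sequential.

(* Nonnegativity of q follows from these two axioms. *)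
Definition seminorm (R : realType) (X : lmodType R) (q : X -> R) :=
  (forall x y, q (x + y) <= q x + q y) /\
  (forall (a : R) x, q (a *: x) = `|a| * q x).

Record localizing_family (R : realType) (X : lmodType R)
    (C : set (set X)) : Prop := LocalizingFamily {
  localizing_nonempty : C !=set0 ;
  localizing_convex : forall A, C A -> convex_set A ;
  localizing_zero : forall A, C A -> A 0 ;
  localizing_affine : forall A (x : X) (t : R), C A ->
    exists2 D, C D & [set x + t *: y | y in A] `<=` D
}.

Definition nondecreasing_countable (X : Type) (C : set (set X)) :=
  exists F : nat -> set X, C = range F /\ forall k, F k `<=` F k.+1.

Definition trace_topology (X : topologicalType) (A : set X) : set (set X) :=
  [set E `&` A | E in open].

(* Copy of X carrying the topology localized along C; the original topology
   stays the one attached to X itself. *)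
Definition localization (R : realType) (X : tvsType R) (C : set (set X)) : Type
  := X.

Section Localization.
Context (R : realType) (X : tvsType R) (C : set (set X)).

Definition localized_open : set (set X) :=
  [set E | forall x, E x -> exists V : set X,
    [/\ convex_set V, V x, V `<=` E &
        forall A, C A -> trace_topology A (V `&` A)]].

Let localized_openT : localized_open setT.
Proof.
move=> x _; exists setT; split=> // A _.
by exists setT; first exact: openT.
Qed.

Let localized_openI : setI_closed localized_open.
Proof.
move=> E F oE oF x [/oE[V [cV Vx VE tV]] /oF[W [cW Wx WF tW]]].
exists (V `&` W); split=> //.
- move=> a b l /set_mem[Va Wa] /set_mem[Vb Wb]; apply/mem_set; split.
    by apply/set_mem/cV; exact/mem_set.
  by apply/set_mem/cW; exact/mem_set.
- exact: setISS.
- move=> A CA; have [E' oE' EV] := tV A CA; have [F' oF' FW] := tW A CA.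
  exists (E' `&` F'); first exact: openI.
  by rewrite setIIl EV FW -setIIl.
Qed.

Let localized_open_bigU (I : Type) (f : I -> set X) :
  (forall i, localized_open (f i)) -> localized_open (\bigcup_i f i).
Proof.
move=> of_ x [i _ /(of_ i)[V [cV Vx Vf tV]]].
by exists V; split=> // y /Vf; exists i.
Qed.

HB.instance Definition _ := GRing.Lmodule.copy (localization C) X.
HB.instance Definition _ := isOpenTopological.Build (localization C)
  localized_openT localized_openI localized_open_bigU.

Lemma open_localizationE : @open (localization C) = localized_open.
Proof. by []. Qed.

End Localization.

(* Main.v *)
(** A convex set [V] may serve as its own witness in the definition of
    [T_C]-openness, so it is enough that its trace on each [A] in [C] be open
    in [A], i.e. sequentially open in [A]; and a sequence converging in
    [T|_A] also converges for [T_C].  Linear maps are handled by pulling back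
    convex open sets, and seminorms by pulling back the half-line below [e],
    whose preimage is a convex neighbourhood of 0 that can be translated. *)
Require Import Defs.
From HB Require Import structures.
From mathcomp Require Import all_boot all_order all_algebra.
From mathcomp Require Import all_classical all_reals all_analysis.
Import Order.TTheory GRing.Theory Num.Theory.
Import numFieldNormedType.Exports.
Local Open Scope classical_set_scope.
Local Open Scope ring_scope.

Lemma continuous_sequentially (S T : topologicalType) (f : S -> T) :
  continuous f -> sequentially_continuous f.
Proof. by move=> cf u x ux; exact: (cvg_comp _ _ ux (cf x)). Qed.

Lemma sequentially_open_preimage (S T : topologicalType) (f : S -> T)
    (E : set T) :
  sequentially_continuous f -> open E -> sequentially_open (f @^-1` E).
Proof. by move=> cf oE u x /cf fux Efx; apply: fux; exact: open_nbhs_nbhs. Qed.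

Lemma convex_set_preimage (R : realType) (X Y : lmodType R)
    (f : {linear X -> Y}) (E : set Y) :
  convex_set E -> convex_set (f @^-1` E).
Proof.
move=> cE x y l /set_mem Ex /set_mem Ey; apply/mem_set.
have /set_mem := cE (f x) (f y) l (mem_set Ex) (mem_set Ey).
by rewrite /preimage /= linearD !linearZ.
Qed.

Lemma convex_set_translate (R : realType) (X : lmodType R) (x : X)
    (V : set X) :
  convex_set V -> convex_set [set y | V (y + x)].
Proof.
move=> cV a b l /set_mem Va /set_mem Vb; apply/mem_set.
have /set_mem := cV _ _ l (mem_set Va) (mem_set Vb).
(* The two weights add up to 1, so the combination of the two copies of [x] is [x] itself. *)
suff -> : (conv l (a + x : convex_lmodType X) (b + x) : X) =
    conv l a b + x.
  by [].
by rewrite /conv /= !scalerDr addrACA -scalerDl subrKC scale1r.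
Qed.

Lemma seminorm_convex_ball (R : realType) (X : lmodType R) (q : X -> R)
    (e : R) :
  seminorm q -> convex_set (q @^-1` [set r | r < e]).
Proof.
(* [convex_setW] leaves only weights strictly between 0 and 1; both are then positive, so
   multiplying by them preserves the strict inequalities. *)
move=> [qD qZ]; apply/convex_setW => a b /set_mem qa /set_mem qb l l0 l1.
apply/mem_set.
rewrite /conv /=; apply: (le_lt_trans (qD _ _)).
rewrite !qZ !gtr0_norm ?subr_gt0//.
have -> : e = l%:num * e + (1 - l%:num) * e by rewrite -mulrDl subrKC mul1r.
by apply: ltrD; rewrite ltr_pM2l ?subr_gt0.
Qed.

Lemma seminorm0 (R : realType) (X : lmodType R) (q : X -> R) :
  seminorm q -> q 0 = 0.
Proof. by move=> [_ qZ]; rewrite -(scale0r (0 : X)) qZ normr0 mul0r. Qed.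

Lemma seminorm_dist (R : realType) (X : lmodType R) (q : X -> R) x y :
  seminorm q -> `|q x - q y| <= q (y - x).
Proof.
move=> [qD qZ]; rewrite ler_distl lerBlDr; apply/andP; split.
  by rewrite -{1}(subrKC x y) qD.
(* Here [x] is written as [y] plus [-1] times [y - x]; homogeneity then absorbs the sign. *)
rewrite -{1}(subrKC y x) -(opprB y x) -(scaleN1r (y - x)).
by rewrite (le_trans (qD _ _))// qZ normrN1 mul1r.
Qed.

Section Localization.
Context (R : realType) (X : tvsType R) (C : set (set X)).

(** A localized neighbourhood of the limit contains some [V] that agrees on [A] with an open set [W]
    of the original topology. The sequence is eventually in [W] and never leaves [A], hence is
    eventually in [V]. *)
Lemma cvg_localization (A : set X) (u : nat -> set_type A) (x : set_type A) :
  C A -> u @ \oo --> x ->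
  (fun n => set_val (u n) : localization C) @ \oo -->
    (set_val x : localization C).
Proof.
move=> CA ux B /=; rewrite nbhsE => -[E [oE Ex EB]].
have [V [_ Vx VE tV]] := oE _ Ex; have [W oW WV] := tV A CA.
have Wx : W (set_val x).
  have : (V `&` A) (set_val x) by split=> //; exact: set_valP.
  by rewrite -WV => -[].
have /ux : nbhs x (set_val @^-1` W).
  by apply: open_nbhs_nbhs; split=> //; exists W.
apply: (@filterS _ \oo) => n Wn; apply/EB/VE.
have : (W `&` A) (set_val (u n)) by split=> //; exact: set_valP.
by rewrite WV => -[].
Qed.

Lemma convex_sequentially_open_localization (V : set X) :
  (forall A, C A -> sequential_space (set_type A)) -> convex_set V ->
  sequentially_open (V : set (localization C)) ->
  open (V : set (localization C)).
Proof.
move=> hseq cV sV; rewrite open_localizationE => x Vx; exists V; split=> // A CA.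
have [W oW WV] : open (set_val @^-1` V : set (set_type A)).
  by apply: hseq => // u a /(cvg_localization _ _ _ CA) ua Va; exact: sV ua Va.
exists W => //; rewrite predeqE => y.
(* [WV] equates preimages in [set_type A]; evaluating it at the point given by [y] and [Ay] turns it
   into an equality of traces on [A]. *)
have VWE (Ay : A y) : W y = V y.
  have := congr1 (fun B : set (set_type A) => B (exist _ y (mem_set Ay))) WV.
  by [].
by split=> -[+ Ay]; rewrite ?VWE// -?VWE.
Qed.

(** The trace on [A] of a translate of [V] is governed by the trace of [V] on a member [D] of [C]
    containing [x + A], and translations are continuous for the original topology. *)
Lemma continuous_translate_localization (x : localization C) :
  localizing_family C ->
  continuous (fun y : localization C => y + x).
Proof.
move=> hC; apply/continuousP => E; rewrite !open_localizationE => oE y Eyx.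
have [V [cV Vyx VE tV]] := oE _ Eyx.
exists [set z | V (z + x)]; split=> //.
- exact: convex_set_translate.
- by move=> z /VE.
move=> A CA; have [D CD AD] := localizing_affine hC x 1 CA.
have [W oW WV] := tV D CD.
exists [set z | W (z + x)].
  have /continuousP : continuous (fun z : X => z + (x : X)).
    move=> z; apply: (@continuous2_cvg _ _ _ _ _ _
      id (cst (x : X)) (fun a b : X => a + b)).
    - exact: (add_continuous (z, x : X)).
    - exact: cvg_id.
    - exact: cvg_cst.
  exact.
rewrite predeqE => z; split=> -[Hz Az].
(* For [z] in [A] the point [z + x] lies in [D], where [W] and [V] agree; this settles both
   inclusions. *)
all: have Dzx : D (z + x) by apply: AD; exists z; rewrite // scale1r addrC.
all: split=> //=.
- by have : (W `&` D) (z + x) by []; rewrite WV => -[].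
- by have : (V `&` D) (z + x) by []; rewrite -WV => -[].
Qed.

End Localization.

Theorem theorem3p2 (R : realType) (X : tvsType R) (C : set (set X))
    (hX : hausdorff_space X)
    (hC : localizing_family C)
    (hmono : nondecreasing_countable C)
    (hclosed : forall A : set X, C A -> closed A)
    (hseq : forall A : set X, C A -> sequential_space (set_type A)) :
  [/\ forall V : set X, convex_set V ->
        sequentially_open (V : set (localization C)) ->
        open (V : set (localization C)),
      forall (Y : tvsType R) (f : {linear X -> Y}), hausdorff_space Y ->
        (continuous (f : localization C -> Y) <->
         sequentially_continuous (f : localization C -> Y))
    & forall q : X -> R, seminorm q ->
        (continuous (q : localization C -> R) <->
         sequentially_continuous (q : localization C -> R))].
Proof.
have openV := fun V => convex_sequentially_open_localization _ _ _ V hseq.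
split; first exact: openV.
- move=> Y f _; split; first exact: continuous_sequentially.
  (* Since [openV] handles convex sets only, [B] is first shrunk to a member [E] of a base of convex
     open sets of [Y]. *)
  move=> sf x B; have [K Kconv [Kopen Kbasis]] := @locally_convex R Y.
  move=> /Kbasis[E [KE Efx] EB].
  suff : nbhs (x : localization C) (f @^-1` E).
    by apply: filterS => y; exact: EB.
  apply: open_nbhs_nbhs; split=> //; apply: openV.
    by apply: convex_set_preimage; apply: Kconv; exact: mem_set.
  exact: (sequentially_open_preimage _ _ _ _ sf (Kopen _ KE)).
- move=> q nq; split; first exact: continuous_sequentially.
  move=> sq x.
  apply/(@cvgrPdist_lt _ _ _ _ (nbhs_filter (x : localization C))) => e e0.
  have oB : open (q @^-1` [set r | r < e] : set (localization C)).
    apply: openV; first exact: seminorm_convex_ball.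
    exact: (sequentially_open_preimage _ _ _ _ sq (@open_lt _ e)).
  have := continuous_translate_localization _ _ _ (- x) hC.
  move=> /continuousP/(_ _ oB) oBx.
  (* The ball centred at [x] is the preimage of the one centred at 0 under translation by [- x], and
     by [seminorm_dist] it controls the variation of [q] near [x]. *)
  suff : nbhs (x : localization C) [set y | q (y - x) < e].
    apply: (@filterS _ _ (nbhs_filter _)) => y.
    exact/le_lt_trans/seminorm_dist.
  apply: open_nbhs_nbhs; split=> //=.
  by rewrite subrr seminorm0.
Qed.
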